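(* A monotone linear operator $A:\mathbb{R}^2\to\mathbb{R}^2$ is paramonotone if and only if it is strictly monotone or symmetric.
   Context: $\mathbb{R}^2$ carries its standard inner product. A linear operator $A:\mathbb{R}^2\to\mathbb{R}^2$ (defined everywhere) is monotone if $\langle x-y,Ax-Ay\rangle\ge0$ for all $x,y$. It is paramonotone if it is monotone and $\langle x-y,Ax-Ay\rangle=0$ implies $Ax=Ay$. It is strictly monotone if it is monotone and $\langle x-y,Ax-Ay\rangle=0$ implies $x=y$. It is symmetric if $A=A^*$, i.e. its matrix in the standard basis is symmetric. *)

(* Defs.v *)
From HB Require Import structures.
From mathcomp Require Import all_boot all_order all_algebra.
From mathcomp Require Import reals.

Set Implicit Arguments.
Unset Strict Implicit.
Unset Printing Implicit Defensive.

Import Order.TTheory GRing.Theory Num.Theory.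
Local Open Scope ring_scope.

Definition inner (R : realType) (n : nat) (x y : 'rV[R]_n) : R :=
  \sum_(i < n) x 0 i * y 0 i.

Definition monotone_op (R : realType) (n : nat)
    (A : 'rV[R]_n -> 'rV[R]_n) : Prop :=
  forall x y, 0 <= inner (x - y) (A x - A y).

Definition paramonotone_op (R : realType) (n : nat)
    (A : 'rV[R]_n -> 'rV[R]_n) : Prop :=
  monotone_op A /\
  forall x y, inner (x - y) (A x - A y) = 0 -> A x = A y.

Definition strictly_monotone_op (R : realType) (n : nat)
    (A : 'rV[R]_n -> 'rV[R]_n) : Prop :=
  monotone_op A /\
  forall x y, inner (x - y) (A x - A y) = 0 -> x = y.

(* [lin1_mx A] acts on row vectors by right multiplication, so it is the
   transpose of the usual (column-vector) matrix of [A] in the standard basis;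
   its symmetry is the same condition. *)
Definition symmetric_op (R : realType) (n : nat)
    (A : {linear 'rV[R]_n -> 'rV[R]_n}) : Prop :=
  (lin1_mx A)^T = lin1_mx A.

(* Main.v *)
Require Import Defs.
From mathcomp Require Import all_boot all_order all_algebra.
From mathcomp Require Import reals ring lra.
Set Implicit Arguments.
Unset Strict Implicit.
Unset Printing Implicit Defensive.
Import Order.TTheory GRing.Theory Num.Theory.
Local Open Scope ring_scope.

(** Write [q z] for [inner z (A z)]. By linearity, monotonicity says that [q]
    is nonnegative, and both paramonotonicity and strict monotonicity are
    conditions on the zeros of [q]. A zero [z] of [q] is a minimum, so the
    derivative of [q] at [z] vanishes: [inner w (A z) + inner z (A w) = 0] for
    all [w] (lemma [monotone_null_polar]). The two nontrivial implications
    both come from this identity.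

    If [A] is symmetric, the two summands agree, so [A z] is orthogonal to
    every [w], hence zero; this is paramonotonicity, in any dimension.

    Conversely, let [A] be paramonotone on the plane and let [z] be a nonzero
    zero of [q]. Then [A z = 0], so the identity gives [inner z (A w) = 0]:
    the form [inner z (A w) - inner (A z) w] vanishes for all [w]. In dimension
    two this alternating form is a multiple of the determinant of [z] and [w],
    the factor being the difference of the off-diagonal entries of the matrix
    of [A] (lemma [plane_skew_form]). Taking for [w] a quarter turn of [z]
    makes the determinant nonzero, so the off-diagonal entries are equal. *)

(** * Bilinearity of the inner product *)

Section Inner.
Variables (R : realType) (n : nat).
Implicit Types x y z : 'rV[R]_n.

Lemma innerC x y : inner x y = inner y x.
Proof. by apply: eq_bigr => i _; rewrite mulrC. Qed.

Lemma innerDl x y z : inner (x + y) z = inner x z + inner y z.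
Proof. by rewrite -big_split; apply: eq_bigr => i _; rewrite mxE mulrDl. Qed.

Lemma innerDr x y z : inner x (y + z) = inner x y + inner x z.
Proof. by rewrite innerC innerDl !(innerC x). Qed.

Lemma innerZl a x y : inner (a *: x) y = a * inner x y.
Proof. by rewrite mulr_sumr; apply: eq_bigr => i _; rewrite mxE mulrA. Qed.

Lemma innerZr a x y : inner x (a *: y) = a * inner x y.
Proof. by rewrite innerC innerZl innerC. Qed.

Lemma inner0r x : inner x 0 = 0.
Proof. by rewrite -(scale0r 0) innerZr mul0r. Qed.

Lemma inner_eq0 x : inner x x = 0 -> x = 0.
Proof.
move=> xx0; apply/rowP => i; rewrite mxE; apply/eqP.
have /psumr_eq0P/(_ xx0 i isT) : forall j, true -> 0 <= x 0 j * x 0 j.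
  by move=> j _; rewrite -expr2 sqr_ge0.
by move/eqP; rewrite mulf_eq0 orbb.
Qed.

Lemma inner_mulmx x y : inner x y = (x *m y^T) 0 0.
Proof. by rewrite mxE; apply: eq_bigr => i _; rewrite mxE. Qed.

End Inner.

(** * Zeros of the quadratic form of a monotone operator *)

Section Monotone.
Variables (R : realType) (n : nat) (A : {linear 'rV[R]_n -> 'rV[R]_n}).

Lemma monotone_inner_ge0 : monotone_op A -> forall z, 0 <= inner z (A z).
Proof. by move=> hA z; have := hA z 0; rewrite (linear0 A) !subr0. Qed.

(** The quadratic form attains its minimum [0] at [z], so its derivative there
    vanishes in every direction [w]. *)
Lemma monotone_null_polar z w : monotone_op A ->
  inner z (A z) = 0 -> inner w (A z) + inner z (A w) = 0.
Proof.
move=> /monotone_inner_ge0 q_ge0 qz0.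
set b := (X in X = 0); pose c := inner w (A w).
have c_ge0 : 0 <= c by exact: q_ge0.
have q_line t : 0 <= t * b + t ^+ 2 * c.
  have := q_ge0 (z + t *: w); rewrite linearD linearZ /=.
  rewrite !innerDl !innerDr !innerZl !innerZr qz0 /b /c.
  by congr (0 <= _); ring.
have c1_neq0 : c + 1 != 0 by apply: lt0r_neq0; lra.
(* Dividing by [c + 1] rather than [c] also covers [c = 0], and makes the value
   at this point exactly [- (b / (c + 1)) ^+ 2]. *)
have := q_line (- (b / (c + 1))).
have -> : - (b / (c + 1)) * b + (- (b / (c + 1))) ^+ 2 * c
          = - (b / (c + 1)) ^+ 2 by field.
rewrite oppr_ge0 => sq_le0.
have : (b / (c + 1)) ^+ 2 == 0 by rewrite eq_le sq_le0 sqr_ge0.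
by rewrite sqrf_eq0 mulf_eq0 invr_eq0 (negPf c1_neq0) orbF => /eqP.
Qed.

Lemma symmetric_op_inner : symmetric_op A ->
  forall x y, inner (A x) y = inner x (A y).
Proof.
move=> symA x y.
by rewrite !inner_mulmx -!(mul_rV_lin1 A) trmx_mul symA mulmxA.
Qed.

Lemma symmetric_monotone_paramonotone :
  monotone_op A -> symmetric_op A -> paramonotone_op A.
Proof.
move=> hA symA; split=> // x y; rewrite -linearB => qz0.
apply/eqP; rewrite -subr_eq0 -linearB; apply/eqP/inner_eq0.
have := monotone_null_polar (A (x - y)) hA qz0.
by rewrite -(symmetric_op_inner symA (x - y)); lra.
Qed.

End Monotone.

(** * The plane *)

(** The left-hand side is an alternating bilinear form in [z] and [w], and on
    the plane such forms are the multiples of the determinant. *)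
Lemma plane_skew_form (R : realType) (A : {linear 'rV[R]_2 -> 'rV[R]_2})
    (z w : 'rV[R]_2) :
  inner z (A w) - inner (A z) w =
  (lin1_mx A 0 1 - lin1_mx A 1 0) * (w 0 0 * z 0 1 - w 0 1 * z 0 0).
Proof.
rewrite -!(mul_rV_lin1 A); move: (lin1_mx A) => M.
rewrite /inner !big_ord_recl !big_ord0 !mxE !big_ord_recl !big_ord0.
have -> : lift ord0 ord0 = 1 :> 'I_2 by apply: val_inj.
have -> : ord0 = 0 :> 'I_2 by [].
by ring.
Qed.

Lemma plane_symmetric_op (R : realType) (A : {linear 'rV[R]_2 -> 'rV[R]_2}) :
  lin1_mx A 0 1 = lin1_mx A 1 0 -> symmetric_op A.
Proof.
move=> offdiag; apply/matrixP => i j; rewrite mxE.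
have I2P (k : 'I_2) : k = 0 \/ k = 1.
  by case: k => [[|[|k]] hk] //; [left | right]; apply: val_inj.
by case: (I2P i) => ->; case: (I2P j) => ->.
Qed.

Lemma plane_null_symmetric (R : realType) (A : {linear 'rV[R]_2 -> 'rV[R]_2})
    (z : 'rV[R]_2) :
  monotone_op A -> z != 0 -> A z = 0 -> symmetric_op A.
Proof.
move=> hA z_neq0 Az0; apply: plane_symmetric_op; apply/eqP.
rewrite -subr_eq0.
(* [w] is [z] turned by a right angle, so its determinant with [z] is the
   squared length of [z]. *)
pose w : 'rV[R]_2 := \row_j (if j == 0 then z 0 1 else - z 0 0).
have qz0 : inner z (A z) = 0 by rewrite Az0 inner0r.
have := monotone_null_polar w hA qz0.
rewrite Az0 inner0r add0r => zAw0.
have := plane_skew_form A z w.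
rewrite zAw0 Az0 innerC inner0r subr0 !mxE /=.
have -> : z 0 1 * z 0 1 - - z 0 0 * z 0 0 = inner z z.
  rewrite /inner !big_ord_recl big_ord0.
  have -> : lift ord0 ord0 = 1 :> 'I_2 by apply: val_inj.
  have -> : ord0 = 0 :> 'I_2 by [].
  by ring.
move/esym/eqP; rewrite mulf_eq0 => /orP[//|/eqP/inner_eq0 z0].
by rewrite z0 eqxx in z_neq0.
Qed.

Theorem proposition6p6 (R : realType) (A : {linear 'rV[R]_2 -> 'rV[R]_2})
    (hA : monotone_op A) :
  paramonotone_op A <-> strictly_monotone_op A \/ symmetric_op A.
Proof.
split=> [[_ paraA] | [[_ strictA] | symA]].
- have [symA | nsymA] := eqVneq (lin1_mx A)^T (lin1_mx A); first by right.
  left; split=> // x y /paraA Axy; apply/eqP; rewrite -subr_eq0.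
  apply: contraNT nsymA => z_neq0; apply/eqP.
  by apply: (plane_null_symmetric hA z_neq0); rewrite linearB /= Axy subrr.
- by split=> // x y /strictA ->.
- exact: symmetric_monotone_paramonotone.
Qed.
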